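(* Consider the parametric weighted affiliation random graph mixture model with $Q\ge2$ groups, and assume the family $\mathcal M=\{F(\cdot,\theta):\theta\in\Theta\}$ satisfies: (i) no $F(\cdot,\theta)$ has a point mass at $0$; (ii) finite mixtures from $\mathcal M$ are identifiable up to label swapping (for every $r\ge1$, $\sum_{i=1}^r a_iF(\cdot,\theta_i)=\sum_{i=1}^r a_i'F(\cdot,\theta_i')$ implies $\sum_i a_i\delta_{\theta_i}=\sum_i a_i'\delta_{\theta_i'}$). If $\theta_{\rm in}\ne\theta_{\rm out}$, then $\alpha,\beta,\theta_{\rm in},\theta_{\rm out}$ are strictly identifiable from the joint distribution of $K_3$, and, these being identified, the group priors $\boldsymbol\pi$ are identifiable, up to label swapping, from the joint distribution of $K_Q$.
   Context: Random graph mixture model: nodes have i.i.d. latent groups $Z_i\in\{1,\dots,Q\}$ with $\pi_q=\mathbb P(Z_i=q)\in(0,1)$, $\sum_q\pi_q=1$; edge variables $X_{ij}$ ($i<j$) are conditionally independent given all $Z$'s, with law of $X_{ij}$ depending only on $(Z_i,Z_j)$. Parametric weighted affiliation model: $X_{ij}$ takes values in $\mathbb N$, $\mathbb R$ or $\mathbb R^s$ and, given $Z_i=q,Z_j=l$, has law $(1-\alpha)\delta_0+\alpha F(\cdot,\theta_{\rm in})$ if $q=l$ and $(1-\beta)\delta_0+\beta F(\cdot,\theta_{\rm out})$ if $q\ne l$, with $\alpha,\beta\in(0,1]$, $\theta_{\rm in},\theta_{\rm out}\in\Theta\subset\mathbb R^p$, $\delta_0$ the Dirac mass at $0$. $K_n$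 denotes the collection of the $\binom n2$ edge variables among $n$ nodes. *)

(* Defs.v *)
From Stdlib Require Import Reals Lra Lia List Classical ClassicalEpsilon.
Import ListNotations.
Open Scope R_scope.

Fixpoint fsum (n : nat) (f : nat -> R) : R :=
  match n with O => 0 | S m => fsum m f + f m end.
Fixpoint fprod (n : nat) (f : nat -> R) : R :=
  match n with O => 1 | S m => fprod m f * f m end.

Definition is_sigma_algebra {X : Type} (meas : (X -> Prop) -> Prop) : Prop :=
  meas (fun _ => True) /\
  (forall A, meas A -> meas (fun x => ~ A x)) /\
  (forall A : nat -> (X -> Prop), (forall n, meas (A n)) ->
     meas (fun x => exists n, A n x)).

Definition is_prob_measure {X : Type} (meas : (X -> Prop) -> Prop)
    (mu : (X -> Prop) -> R) : Prop :=
  (forall A, meas A -> 0 <= mu A) /\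
  mu (fun _ => True) = 1 /\
  (forall A : nat -> (X -> Prop),
     (forall n, meas (A n)) ->
     (forall m n x, m <> n -> A m x -> A n x -> False) ->
     infinite_sum (fun n => mu (A n)) (mu (fun x => exists n, A n x))).

Definition ind {T : Type} (B : T -> Prop) (t : T) : R :=
  if excluded_middle_informative (B t) then 1 else 0.

Definition dirac {X : Type} (x0 : X) (A : X -> Prop) : R := ind A x0.

Definition no_atom_at {X Theta : Type} (x0 : X) (F : Theta -> (X -> Prop) -> R)
  : Prop :=
  forall th, F th (fun x => x = x0) = 0.

Definition finite_mixtures_identifiable {X Theta : Type}
    (meas : (X -> Prop) -> Prop) (F : Theta -> (X -> Prop) -> R) : Prop :=
  forall (r : nat) (a a' : nat -> R) (t t' : nat -> Theta),
    (1 <= r)%nat ->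
    (forall i, (i < r)%nat -> 0 < a i) ->
    (forall i, (i < r)%nat -> 0 < a' i) ->
    fsum r a = 1 -> fsum r a' = 1 ->
    (forall A, meas A ->
       fsum r (fun i => a i * F (t i) A) = fsum r (fun i => a' i * F (t' i) A)) ->
    forall B : Theta -> Prop,
      fsum r (fun i => a i * dirac (t i) B) = fsum r (fun i => a' i * dirac (t' i) B).

Definition edge_law {X Theta : Type} (x0 : X) (F : Theta -> (X -> Prop) -> R)
    (alpha beta : R) (th_in th_out : Theta) (q l : nat) (A : X -> Prop) : R :=
  if Nat.eqb q l
  then (1 - alpha) * dirac x0 A + alpha * F th_in A
  else (1 - beta) * dirac x0 A + beta * F th_out A.

Fixpoint assignments (Q n : nat) : list (list nat) :=
  match n with
  | O => [ [] ]
  | S m => flat_map (fun z => map (fun q => z ++ [q]) (seq 0 Q)) (assignments Q m)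
  end.

Fixpoint lsum (l : list R) : R :=
  match l with [] => 0 | x :: l' => x + lsum l' end.

Definition joint_rect {X Theta : Type} (x0 : X) (F : Theta -> (X -> Prop) -> R)
    (Q : nat) (pi : nat -> R) (alpha beta : R) (th_in th_out : Theta)
    (n : nat) (A : nat -> nat -> (X -> Prop)) : R :=
  lsum (map (fun z =>
      fprod n (fun i => pi (nth i z O)) *
      fprod n (fun j => fprod j (fun i =>
         edge_law x0 F alpha beta th_in th_out (nth i z O) (nth j z O) (A i j))))
    (assignments Q n)).

(* Two parameter values give the same joint distribution of K_n:
   equality on all measurable rectangles (a pi-system generating the
   product sigma-algebra, hence equivalent to equality of the joint laws). *)
Definition same_law_K {X Theta : Type} (meas : (X -> Prop) -> Prop) (x0 : X)
    (F : Theta -> (X -> Prop) -> R) (Q n : nat)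
    (pi : nat -> R) (alpha beta : R) (th_in th_out : Theta)
    (pi' : nat -> R) (alpha' beta' : R) (th_in' th_out' : Theta) : Prop :=
  forall A : nat -> nat -> (X -> Prop),
    (forall i j, (i < j < n)%nat -> meas (A i j)) ->
    joint_rect x0 F Q pi alpha beta th_in th_out n A =
    joint_rect x0 F Q pi' alpha' beta' th_in' th_out' n A.

Definition valid_params {Theta : Type} (Q : nat) (pi : nat -> R) (alpha beta : R)
    (th_in th_out : Theta) : Prop :=
  (forall q, (q < Q)%nat -> 0 < pi q < 1) /\ fsum Q pi = 1 /\
  0 < alpha <= 1 /\ 0 < beta <= 1 /\ th_in <> th_out.

Definition is_perm (Q : nat) (sigma : nat -> nat) : Prop :=
  (forall q, (q < Q)%nat -> (sigma q < Q)%nat) /\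
  (forall q q', (q < Q)%nat -> (q' < Q)%nat -> sigma q = sigma q' -> q = q').

(* Main.v *)
Require Import Defs.
From Stdlib Require Import Reals.
From Stdlib Require Import Lra Lia List Permutation Classical ClassicalEpsilon FunctionalExtensionality.
Import ListNotations.
Open Scope R_scope.

(* The law of K_n on a rectangle is a sum over label assignments of products of edge
   weights, hence multilinear in the edge weights, and each edge weight is a linear
   functional of (delta_0(A), F(A, th_in), F(A, th_out)). These three coordinates can be
   prescribed freely, using {0}, the whole space and a set separating F th_in from
   F th_out, so equality on rectangles extends to arbitrary edge weights.
   On K_3 one edge has law (1 - m) delta_0 + s2 alpha F th_in + (1 - s2) beta F th_out
   with s2 = sum_q pi_q^2, and identifiability of finite mixtures yields {th_in, th_out}.
   Triangle moments involve only s2 and s3 = sum_q pi_q^3: they rule out swapped labels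
   and give alpha, then s2 and beta. Once the edge parameters are known, the star
   weights forcing the nodes 0, ..., k-1 into one group give the power sums
   sum_q pi_q^k for k <= Q, which determine the multiset of the pi_q by Newton's
   identities. *)

Lemma fsum_ext n f g : (forall k, (k < n)%nat -> f k = g k) -> fsum n f = fsum n g.
Proof.
  induction n as [|n IH]; intros H; simpl; [reflexivity|].
  rewrite IH, (H n); [reflexivity | lia | intros k Hk; apply H; lia].
Qed.

Lemma fprod_ext n f g : (forall k, (k < n)%nat -> f k = g k) -> fprod n f = fprod n g.
Proof.
  induction n as [|n IH]; intros H; simpl; [reflexivity|].
  rewrite IH, (H n); [reflexivity | lia | intros k Hk; apply H; lia].
Qed.

Lemma fsum_scal_l n c f : fsum n (fun k => c * f k) = c * fsum n f.
Proof. induction n as [|n IH]; simpl; [|rewrite IH]; ring. Qed.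

Lemma fsum_plus n f g : fsum n (fun k => f k + g k) = fsum n f + fsum n g.
Proof. induction n as [|n IH]; simpl; [|rewrite IH]; ring. Qed.

Lemma fsum_minus n f g : fsum n (fun k => f k - g k) = fsum n f - fsum n g.
Proof. induction n as [|n IH]; simpl; [|rewrite IH]; ring. Qed.

Lemma fsum_shift n f : fsum (S n) f = f O + fsum n (fun k => f (S k)).
Proof. induction n as [|n IH]; [simpl; ring|]. cbn [fsum] in *. rewrite IH. ring. Qed.

Lemma fsum_pos n f : (1 <= n)%nat -> (forall k, (k < n)%nat -> 0 < f k) -> 0 < fsum n f.
Proof.
  induction n as [|[|n] IH]; intros Hn Hf; [lia| |].
  - simpl. specialize (Hf O ltac:(lia)). lra.
  - cbn [fsum] in *. assert (0 < fsum n f + f n) by (apply IH; [lia | intros; apply Hf; lia]).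
    specialize (Hf (S n) ltac:(lia)). lra.
Qed.

Lemma fsum_kronecker n p h : (p < n)%nat ->
  fsum n (fun q => if Nat.eqb p q then h q else 0) = h p.
Proof.
  induction n as [|n IH]; intros Hp; [lia|]. simpl.
  destruct (Nat.eqb_spec p n) as [->|Hne].
  - rewrite (fsum_ext _ _ (fun _ => 0 * h n)), fsum_scal_l; [ring|].
    intros k Hk. destruct (Nat.eqb_spec n k); [lia | ring].
  - rewrite IH by lia. ring.
Qed.

Lemma fprod_one n : fprod n (fun _ => 1) = 1.
Proof. induction n as [|n IH]; simpl; [|rewrite IH]; ring. Qed.

Lemma fprod_factor_out n k0 a g : (k0 < n)%nat ->
  fprod n (fun k => if Nat.eqb k k0 then a else g k) =
  a * fprod n (fun k => if Nat.eqb k k0 then 1 else g k).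
Proof.
  induction n as [|n IH]; intros Hk0; [lia|]. simpl.
  destruct (Nat.eqb_spec n k0) as [->|Hne].
  - rewrite (fprod_ext k0 (fun k => if Nat.eqb k k0 then a else g k) g),
      (fprod_ext k0 (fun k => if Nat.eqb k k0 then 1 else g k) g); [ring | |];
      intros k Hk; destruct (Nat.eqb_spec k k0); [lia | reflexivity | lia | reflexivity].
  - rewrite IH by lia. ring.
Qed.

Lemma lsum_app l1 l2 : lsum (l1 ++ l2) = lsum l1 + lsum l2.
Proof. induction l1 as [|x l1 IH]; simpl; [|rewrite IH]; ring. Qed.

Lemma lsum_map_ext_in {A} (l : list A) f g :
  (forall x, In x l -> f x = g x) -> lsum (map f l) = lsum (map g l).
Proof.
  induction l as [|x l IH]; simpl; intros H; [reflexivity|].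
  rewrite H, IH by auto. reflexivity.
Qed.

Lemma lsum_map_seq n f : lsum (map f (seq 0 n)) = fsum n f.
Proof. induction n as [|n IH]; [reflexivity|]. rewrite seq_S, map_app, lsum_app, IH. simpl. ring. Qed.

Lemma lsum_map_assignments_S Q n f : lsum (map f (assignments Q (S n))) =
  lsum (map (fun z => fsum Q (fun q => f (z ++ [q]))) (assignments Q n)).
Proof.
  simpl. induction (assignments Q n) as [|z l IH]; [reflexivity|].
  simpl. rewrite map_app, lsum_app, IH, map_map, lsum_map_seq. reflexivity.
Qed.

Lemma in_assignments Q n z : In z (assignments Q n) ->
  length z = n /\ forall q, In q z -> (q < Q)%nat.
Proof.
  revert z; induction n as [|n IH]; simpl; intros z Hz.
  - destruct Hz as [<-|[]]. split; [reflexivity | intros q []].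
  - apply in_flat_map in Hz as [z' [Hz' Hz]]. apply in_map_iff in Hz as [q [<- Hq]].
    apply in_seq in Hq. destruct (IH _ Hz') as [Hlen Hlt].
    split; [rewrite length_app; simpl; lia|].
    intros x Hx. apply in_app_or in Hx as [Hx|[<-|[]]]; [auto | lia].
Qed.

(** * Edge moments *)

(* [edge_moment Q n pi u] is E[prod_{i<j<n} u i j [Z_i = Z_j]] for i.i.d. labels of law [pi]. *)
Definition edge_moment (Q n : nat) (pi : nat -> R) (u : nat -> nat -> bool -> R) : R :=
  lsum (map (fun z => fprod n (fun i => pi (nth i z O)) *
     fprod n (fun j => fprod j (fun i => u i j (Nat.eqb (nth i z O) (nth j z O)))))
   (assignments Q n)).

Definition affil_weight {X Theta : Type} (x0 : X) (F : Theta -> (X -> Prop) -> R)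
    (alpha beta : R) (th_in th_out : Theta) (A : X -> Prop) (same : bool) : R :=
  if same then (1 - alpha) * dirac x0 A + alpha * F th_in A
  else (1 - beta) * dirac x0 A + beta * F th_out A.

Lemma joint_rect_edge_moment {X Theta : Type} (x0 : X) (F : Theta -> (X -> Prop) -> R)
    Q pi alpha beta th_in th_out n A :
  joint_rect x0 F Q pi alpha beta th_in th_out n A =
  edge_moment Q n pi (fun i j => affil_weight x0 F alpha beta th_in th_out (A i j)).
Proof. reflexivity. Qed.

Lemma edge_moment_ext Q n pi u u' :
  (forall i j b, (i < j < n)%nat -> u i j b = u' i j b) ->
  edge_moment Q n pi u = edge_moment Q n pi u'.
Proof.
  intros H. apply lsum_map_ext_in. intros z _. f_equal.
  apply fprod_ext. intros j Hj. apply fprod_ext. intros i Hi. apply H; lia.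
Qed.

Definition upd_edge {T : Type} (V : nat -> nat -> T) (i0 j0 : nat) (w : T) : nat -> nat -> T :=
  fun i j => if andb (Nat.eqb i i0) (Nat.eqb j j0) then w else V i j.

Lemma edge_moment_linear_in_edge Q n pi u i0 j0 : (i0 < j0 < n)%nat ->
  exists K : list nat -> R, forall w,
  edge_moment Q n pi (upd_edge u i0 j0 w) =
  lsum (map (fun z => w (Nat.eqb (nth i0 z O) (nth j0 z O)) * K z) (assignments Q n)).
Proof.
  intros Hij.
  exists (fun z => fprod n (fun i => pi (nth i z O)) *
    (fprod j0 (fun i => if Nat.eqb i i0 then 1 else u i j0 (Nat.eqb (nth i z O) (nth j0 z O))) *
     fprod n (fun j => if Nat.eqb j j0 then 1 else
       fprod j (fun i => u i j (Nat.eqb (nth i z O) (nth j z O)))))).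
  intros w. apply lsum_map_ext_in. intros z _.
  rewrite (fprod_ext n
     (fun j => fprod j (fun i => upd_edge u i0 j0 w i j (Nat.eqb (nth i z O) (nth j z O))))
     (fun j => if Nat.eqb j j0 then
        w (Nat.eqb (nth i0 z O) (nth j0 z O)) *
        fprod j0 (fun i => if Nat.eqb i i0 then 1 else u i j0 (Nat.eqb (nth i z O) (nth j0 z O)))
      else fprod j (fun i => u i j (Nat.eqb (nth i z O) (nth j z O))))).
  - rewrite fprod_factor_out by lia. ring.
  - intros j Hj. unfold upd_edge. destruct (Nat.eqb_spec j j0) as [->|Hne].
    + rewrite <- fprod_factor_out by lia. apply fprod_ext. intros i Hi.
      destruct (Nat.eqb_spec i i0) as [->|]; reflexivity.
    + apply fprod_ext. intros i Hi. rewrite Bool.andb_false_r. reflexivity.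
Qed.

(* Coordinates of an edge law: the atom at [x0], [F a] and [F b]; in these coordinates
   each edge weight is a linear functional [mix (kappa same)]. *)
Inductive component := Atom | CompA | CompB.

Definition comp_law {X Theta : Type} (x0 : X) (F : Theta -> (X -> Prop) -> R) (a b : Theta)
    (A : X -> Prop) (c : component) : R :=
  match c with Atom => dirac x0 A | CompA => F a A | CompB => F b A end.

Definition mix (k v : component -> R) : R :=
  k Atom * v Atom + k CompA * v CompA + k CompB * v CompB.

Definition mixture_moment Q n pi (kappa : bool -> component -> R)
    (V : nat -> nat -> component -> R) : R :=
  edge_moment Q n pi (fun i j b => mix (kappa b) (V i j)).

Lemma mixture_moment_linear_in_edge Q n pi kappa V i0 j0 c0 c1 c2 w0 w1 w2 :
  (i0 < j0 < n)%nat ->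
  (forall c, V i0 j0 c = c0 * w0 c + c1 * w1 c + c2 * w2 c) ->
  mixture_moment Q n pi kappa V =
  c0 * mixture_moment Q n pi kappa (upd_edge V i0 j0 w0) +
  c1 * mixture_moment Q n pi kappa (upd_edge V i0 j0 w1) +
  c2 * mixture_moment Q n pi kappa (upd_edge V i0 j0 w2).
Proof.
  intros Hij HV.
  set (u := fun i j b => mix (kappa b) (V i j)).
  destruct (edge_moment_linear_in_edge Q n pi u i0 j0 Hij) as [K HK].
  assert (Hupd : forall w, mixture_moment Q n pi kappa (upd_edge V i0 j0 w) =
      edge_moment Q n pi (upd_edge u i0 j0 (fun b => mix (kappa b) w))).
  { intros w. unfold mixture_moment. f_equal.
    extensionality i. extensionality j. extensionality b.
    unfold upd_edge, u. destruct (andb _ _); reflexivity. }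
  assert (Hself : mixture_moment Q n pi kappa V =
      edge_moment Q n pi (upd_edge u i0 j0 (fun b => mix (kappa b) (V i0 j0)))).
  { unfold mixture_moment. f_equal.
    extensionality i. extensionality j. extensionality b.
    unfold upd_edge, u. destruct (Nat.eqb_spec i i0), (Nat.eqb_spec j j0); subst; reflexivity. }
  rewrite Hself, !Hupd, !HK. clear Hself Hupd HK.
  induction (assignments Q n) as [|z l IH]; simpl; [ring|].
  rewrite IH. unfold mix. rewrite !HV. ring.
Qed.

(* Replace the edge vectors by combinations of vectors of [S] one edge at a time;
   [L] lists the edges not yet known to carry a vector of [S]. *)
Lemma mixture_moment_span Q n kappa kappa' pi pi' (S : (component -> R) -> Prop) :
  (forall v, exists c0 c1 c2 w0 w1 w2, S w0 /\ S w1 /\ S w2 /\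
     forall c, v c = c0 * w0 c + c1 * w1 c + c2 * w2 c) ->
  (forall V, (forall i j, (i < j < n)%nat -> S (V i j)) ->
     mixture_moment Q n pi kappa V = mixture_moment Q n pi' kappa' V) ->
  forall V, mixture_moment Q n pi kappa V = mixture_moment Q n pi' kappa' V.
Proof.
  intros Hspan Hagree.
  assert (Hpending : forall L V, (forall i j, (i < j < n)%nat -> ~ In (i, j) L -> S (V i j)) ->
      mixture_moment Q n pi kappa V = mixture_moment Q n pi' kappa' V).
  { induction L as [|[i0 j0] L IH]; intros V HV.
    - apply Hagree. intros i j Hij. apply HV; auto.
    - assert (HVL : forall w, S w ->
          forall i j, (i < j < n)%nat -> ~ In (i, j) L -> S (upd_edge V i0 j0 w i j)).
      { intros w Hw i j Hij HL. unfold upd_edge.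
        destruct (Nat.eqb_spec i i0), (Nat.eqb_spec j j0); subst; simpl; [exact Hw | ..];
          apply HV; auto; (intros [Heq|HIn]; [congruence | auto]). }
      assert (Hedge : (i0 < j0 < n)%nat \/ ~ (i0 < j0 < n)%nat) by lia.
      destruct Hedge as [Hedge|Hedge].
      + destruct (Hspan (V i0 j0)) as (c0 & c1 & c2 & w0 & w1 & w2 & S0 & S1 & S2 & Hv).
        rewrite !(mixture_moment_linear_in_edge _ _ _ _ V i0 j0 c0 c1 c2 w0 w1 w2) by auto.
        rewrite !(IH (upd_edge V i0 j0 _)) by auto. reflexivity.
      + apply IH. intros i j Hij HL. apply HV; auto.
        intros [Heq|HIn]; [inversion Heq; subst; lia | auto]. }
  intros V. apply (Hpending (flat_map (fun j => map (fun i => (i, j)) (seq 0 j)) (seq 0 n))).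
  intros i j Hij HL. exfalso. apply HL. apply in_flat_map. exists j. split.
  - apply in_seq. lia.
  - apply in_map_iff. exists i. split; [reflexivity | apply in_seq; lia].
Qed.

Definition affil_kappa (alpha beta : R) (same : bool) (c : component) : R :=
  match same, c with
  | true, Atom => 1 - alpha | true, CompA => alpha
  | false, Atom => 1 - beta | false, CompB => beta
  | _, _ => 0
  end.

Definition comp_swap (c : component) : component :=
  match c with Atom => Atom | CompA => CompB | CompB => CompA end.

Lemma affil_weight_mix {X Theta : Type} (x0 : X) (F : Theta -> (X -> Prop) -> R) al be a b A s :
  affil_weight x0 F al be a b A s = mix (affil_kappa al be s) (comp_law x0 F a b A).
Proof. destruct s; unfold affil_weight, mix; simpl; ring. Qed.

Lemma affil_weight_mix_swap {X Theta : Type} (x0 : X) (F : Theta -> (X -> Prop) -> R) al be a b A s :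
  affil_weight x0 F al be b a A s =
  mix (fun c => affil_kappa al be s (comp_swap c)) (comp_law x0 F a b A).
Proof. destruct s; unfold affil_weight, mix; simpl; ring. Qed.

Lemma dirac_self {T : Type} (t : T) : dirac t (fun s => s = t) = 1.
Proof. unfold dirac, Defs.ind. destruct (excluded_middle_informative (t = t)); [reflexivity | congruence]. Qed.

Lemma dirac_full {T : Type} (t : T) : dirac t (fun _ => True) = 1.
Proof. unfold dirac, Defs.ind. destruct (excluded_middle_informative True); [reflexivity | tauto]. Qed.

(* {x0}, the whole space and [D] give the basis (1,0,0), (1,1,1), (d, F a D, F b D). *)
Lemma comp_law_span {X Theta : Type} (meas : (X -> Prop) -> Prop) (x0 : X)
    (F : Theta -> (X -> Prop) -> R) (a b : Theta) (D : X -> Prop) :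
  meas (fun x => x = x0) -> meas (fun _ => True) -> meas D -> F a D <> F b D ->
  (forall th, F th (fun _ => True) = 1) -> no_atom_at x0 F ->
  forall v : component -> R, exists c0 c1 c2 w0 w1 w2,
    (exists A, meas A /\ w0 = comp_law x0 F a b A) /\
    (exists A, meas A /\ w1 = comp_law x0 F a b A) /\
    (exists A, meas A /\ w2 = comp_law x0 F a b A) /\
    forall c, v c = c0 * w0 c + c1 * w1 c + c2 * w2 c.
Proof.
  intros Hx0 HT HD HFD HF1 Hna v.
  set (c2 := (v CompA - v CompB) / (F a D - F b D)).
  set (c1 := v CompA - c2 * F a D).
  set (c0 := v Atom - c1 - c2 * dirac x0 D).
  exists c0, c1, c2, (comp_law x0 F a b (fun x => x = x0)),
    (comp_law x0 F a b (fun _ => True)), (comp_law x0 F a b D).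
  split; [eauto|]. split; [eauto|]. split; [eauto|].
  assert (F a D - F b D <> 0) by lra.
  intros []; simpl; rewrite ?dirac_self, ?dirac_full, ?Hna, ?HF1;
    unfold c0, c1, c2; field; assumption.
Qed.

Lemma same_law_K_mixture_moment {X Theta : Type} (meas : (X -> Prop) -> Prop) (x0 : X)
    (F : Theta -> (X -> Prop) -> R) (a b : Theta) (D : X -> Prop)
    Q n pi al be ti to pi' al' be' ti' to' kappa kappa' :
  meas (fun x => x = x0) -> meas (fun _ => True) -> meas D -> F a D <> F b D ->
  (forall th, F th (fun _ => True) = 1) -> no_atom_at x0 F ->
  (forall A s, affil_weight x0 F al be ti to A s = mix (kappa s) (comp_law x0 F a b A)) ->
  (forall A s, affil_weight x0 F al' be' ti' to' A s = mix (kappa' s) (comp_law x0 F a b A)) ->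
  same_law_K meas x0 F Q n pi al be ti to pi' al' be' ti' to' ->
  forall V, mixture_moment Q n pi kappa V = mixture_moment Q n pi' kappa' V.
Proof.
  intros Hx0 HT HD HFD HF1 Hna Hk Hk' Hsame.
  apply (mixture_moment_span _ _ _ _ _ _ _ (comp_law_span meas x0 F a b D Hx0 HT HD HFD HF1 Hna)).
  intros V HV.
  destruct (choice (fun (p : nat * nat) A =>
      (fst p < snd p < n)%nat -> meas A /\ V (fst p) (snd p) = comp_law x0 F a b A)) as [A HA].
  { intros [i j]. destruct (classic (i < j < n)%nat) as [Hij|Hij].
    - destruct (HV i j Hij) as [A HA]. exists A. auto.
    - exists (fun _ => True). simpl. tauto. }
  specialize (Hsame (fun i j => A (i, j)) (fun i j Hij => proj1 (HA (i, j) Hij))).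
  rewrite !joint_rect_edge_moment in Hsame. unfold mixture_moment.
  rewrite (edge_moment_ext Q n pi _ (fun i j => affil_weight x0 F al be ti to (A (i, j)))),
    (edge_moment_ext Q n pi' _ (fun i j => affil_weight x0 F al' be' ti' to' (A (i, j))));
    [exact Hsame | |];
    intros i j s Hij; destruct (HA (i, j) Hij) as [_ HVA]; simpl in HVA; rewrite HVA; symmetry; auto.
Qed.

(** * Triangle and star moments *)

Definition power_sum (n : nat) (p : nat -> R) (k : nat) : R := fsum n (fun q => p q ^ k).

Lemma fsum_weight_eqb n a g (w : bool -> R) : (a < n)%nat ->
  fsum n (fun b => g b * w (Nat.eqb a b)) = w false * fsum n g + g a * (w true - w false).
Proof.
  intros Ha.
  rewrite (fsum_ext n _ (fun b => w false * g b + (if Nat.eqb a b then g b * (w true - w false) else 0))).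
  - rewrite fsum_plus, fsum_scal_l, fsum_kronecker by exact Ha. reflexivity.
  - intros b _. destruct (Nat.eqb a b); ring.
Qed.

Lemma fsum_cubic n p c0 c1 c2 :
  fsum n (fun a => p a * (c0 + c1 * p a + c2 * p a ^ 2)) =
  c0 * fsum n p + c1 * power_sum n p 2 + c2 * power_sum n p 3.
Proof.
  unfold power_sum.
  rewrite (fsum_ext n _ (fun a => (c0 * p a + c1 * p a ^ 2) + c2 * p a ^ 3)) by (intros; ring).
  rewrite !fsum_plus, !fsum_scal_l. reflexivity.
Qed.

Definition triangle_moment (Q : nat) (pi : nat -> R) (w01 w02 w12 : bool -> R) : R :=
  fsum Q (fun a => fsum Q (fun b => fsum Q (fun c => pi a * pi b * pi c *
    (w01 (Nat.eqb a b) * w02 (Nat.eqb a c) * w12 (Nat.eqb b c))))).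

Lemma edge_moment_3 Q pi u :
  edge_moment Q 3 pi u = triangle_moment Q pi (u O 1%nat) (u O 2%nat) (u 1%nat 2%nat).
Proof.
  unfold edge_moment. rewrite !lsum_map_assignments_S. simpl. rewrite Rplus_0_r.
  apply fsum_ext; intros a _. apply fsum_ext; intros b _. apply fsum_ext; intros c _. ring.
Qed.

(* Sorting the triples (a, b, c) by their equality pattern: all equal (mass s3),
   exactly one coincident pair (mass s2 - s3 each) or all distinct. *)
Lemma triangle_moment_closed Q pi w01 w02 w12 : fsum Q pi = 1 ->
  triangle_moment Q pi w01 w02 w12 =
  power_sum Q pi 3 * (w01 true * w02 true * w12 true) +
  (power_sum Q pi 2 - power_sum Q pi 3) *
    (w01 true * w02 false * w12 false + w01 false * w02 true * w12 false +
     w01 false * w02 false * w12 true) +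
  (1 - 3 * power_sum Q pi 2 + 2 * power_sum Q pi 3) * (w01 false * w02 false * w12 false).
Proof.
  intros Hpi. unfold triangle_moment.
  set (t01 := w01 true). set (f01 := w01 false). set (t02 := w02 true). set (f02 := w02 false).
  set (t12 := w12 true). set (f12 := w12 false).
  rewrite (fsum_ext Q _ (fun a => pi a *
     ((f01 * f02 * f12 + f01 * f02 * (t12 - f12) * power_sum Q pi 2) +
      (f02 * f12 * (t01 - f01) + f01 * f12 * (t02 - f02)) * pi a +
      (f02 * (t01 - f01) * (t12 - f12) + (t02 - f02) * (t01 * t12 - f01 * f12)) * pi a ^ 2))).
  { rewrite fsum_cubic, Hpi. ring. }
  intros a Ha.
  pose (w01w12 s := w01 s * w12 s).
  rewrite (fsum_ext Q _ (fun b =>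
     (pi a * pi b * (f02 * f12 + f02 * (t12 - f12) * pi b)) * w01 (Nat.eqb a b) +
     (pi a * pi b * pi a * (t02 - f02)) * w01w12 (Nat.eqb a b))).
  { rewrite fsum_plus, !fsum_weight_eqb by exact Ha.
    rewrite (fsum_ext Q (fun b => pi a * pi b * (f02 * f12 + f02 * (t12 - f12) * pi b))
               (fun b => (pi a * (f02 * f12)) * pi b + (pi a * f02 * (t12 - f12)) * pi b ^ 2))
      by (intros; ring).
    rewrite (fsum_ext Q (fun b => pi a * pi b * pi a * (t02 - f02))
               (fun b => (pi a * pi a * (t02 - f02)) * pi b)) by (intros; ring).
    rewrite fsum_plus, !fsum_scal_l, Hpi. unfold power_sum, w01w12. fold t01 f01 t12 f12. ring. }
  intros b Hb.
  rewrite (fsum_ext Q _ (fun c => (pi a * pi b * w01 (Nat.eqb a b) * pi c * w12 (Nat.eqb b c)) *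
                                  w02 (Nat.eqb a c))) by (intros; ring).
  rewrite fsum_weight_eqb by exact Ha.
  rewrite fsum_weight_eqb, fsum_scal_l, Hpi, (Nat.eqb_sym b a) by exact Hb.
  unfold w01w12. fold t02 f02 t12 f12. ring.
Qed.

(* With these weights the product over the edges of K_n is the indicator that the
   nodes 1, ..., k-1 all share the group of node 0. *)
Definition star_weight (k i j : nat) (same : bool) : R :=
  if andb (Nat.eqb i 0) (Nat.ltb j k) then (if same then 1 else 0) else 1.

(* The extra weight [f] on the group of node 0 makes the induction on [n] go through:
   summing out the group of the last node yields [pi (z 0)] if it is tied to node 0, else 1. *)
Definition star_moment (Q : nat) (pi : nat -> R) (k n : nat) (f : nat -> R) : R :=
  lsum (map (fun z => fprod n (fun i => pi (nth i z O)) *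
     fprod n (fun j => fprod j (fun i => star_weight k i j (Nat.eqb (nth i z O) (nth j z O)))) *
     f (nth O z O))
   (assignments Q n)).

Lemma star_moment_S Q pi k n f : fsum Q pi = 1 -> (1 <= n)%nat ->
  star_moment Q pi k (S n) f =
  star_moment Q pi k n (fun q => (if Nat.ltb n k then pi q else 1) * f q).
Proof.
  intros Hpi Hn. unfold star_moment. rewrite lsum_map_assignments_S.
  apply lsum_map_ext_in. intros z Hz.
  destruct (in_assignments _ _ _ Hz) as [Hlen Hlt].
  assert (Hz0 : (nth O z O < Q)%nat) by (apply Hlt, nth_In; lia).
  assert (Hnth : forall q i, (i < n)%nat -> nth i (z ++ [q]) O = nth i z O)
    by (intros; apply app_nth1; lia).
  assert (Hlast : forall q, nth n (z ++ [q]) O = q)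
    by (intros; rewrite app_nth2, <- Hlen, Nat.sub_diag by lia; reflexivity).
  set (W := fprod n (fun i => pi (nth i z O))).
  set (P := fprod n (fun j => fprod j (fun i => star_weight k i j (Nat.eqb (nth i z O) (nth j z O))))).
  rewrite (fsum_ext Q _ (fun q => W * P * f (nth O z O) *
      (pi q * (if Nat.ltb n k then (if Nat.eqb (nth O z O) q then 1 else 0) else 1)))).
  - rewrite fsum_scal_l. destruct (Nat.ltb n k).
    + rewrite (fsum_ext Q _ (fun q => if Nat.eqb (nth O z O) q then pi q else 0)),
        fsum_kronecker by (auto; intros q _; destruct (Nat.eqb _ q); ring).
      ring.
    + rewrite (fsum_ext Q _ pi), Hpi by (intros; ring). ring.
  - intros q Hq. cbn [fprod]. rewrite Hlast.
    rewrite (fprod_ext n (fun i => pi (nth i (z ++ [q]) O)) (fun i => pi (nth i z O)))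
      by (intros; rewrite Hnth; auto).
    rewrite (fprod_ext n (fun j => fprod j (fun i =>
        star_weight k i j (Nat.eqb (nth i (z ++ [q]) O) (nth j (z ++ [q]) O))))
      (fun j => fprod j (fun i => star_weight k i j (Nat.eqb (nth i z O) (nth j z O)))))
      by (intros j Hj; apply fprod_ext; intros i Hi; rewrite !Hnth by lia; reflexivity).
    rewrite (fprod_ext n (fun i => star_weight k i n (Nat.eqb (nth i (z ++ [q]) O) q))
      (fun i => if Nat.eqb i 0
                then (if Nat.ltb n k then (if Nat.eqb (nth O z O) q then 1 else 0) else 1)
                else 1)).
    + rewrite fprod_factor_out,
        (fprod_ext n (fun i => if Nat.eqb i 0 then 1 else 1) (fun _ => 1)), fprod_one, Hnth
        by (lia || (intros i _; destruct (Nat.eqb i 0); reflexivity)).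
      fold W P. ring.
    + intros i Hi. rewrite Hnth by lia. unfold star_weight.
      destruct (Nat.eqb_spec i 0) as [->|]; destruct (Nat.ltb n k); reflexivity.
Qed.

Lemma star_moment_closed Q pi k n f : fsum Q pi = 1 -> (1 <= k)%nat -> (1 <= n)%nat ->
  star_moment Q pi k n f = fsum Q (fun q => pi q ^ Nat.min n k * f q).
Proof.
  intros Hpi Hk Hn. revert f. induction n as [|[|n] IH]; intros f; [lia| |].
  - replace (Nat.min 1 k) with 1%nat by lia.
    unfold star_moment. rewrite lsum_map_assignments_S. simpl. rewrite Rplus_0_r.
    apply fsum_ext. intros q _. ring.
  - rewrite star_moment_S, IH by (auto; lia). apply fsum_ext. intros q _.
    destruct (Nat.ltb_spec (S n) k).
    + replace (Nat.min (S (S n)) k) with (S (Nat.min (S n) k)) by lia. simpl. ring.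
    + replace (Nat.min (S (S n)) k) with (Nat.min (S n) k) by lia. ring.
Qed.

Lemma edge_moment_star Q pi k n : fsum Q pi = 1 -> (1 <= k <= n)%nat ->
  edge_moment Q n pi (star_weight k) = power_sum Q pi k.
Proof.
  intros Hpi Hkn. transitivity (star_moment Q pi k n (fun _ => 1)).
  - apply lsum_map_ext_in. intros z _. ring.
  - rewrite star_moment_closed by (auto; lia). replace (Nat.min n k) with k by lia.
    apply fsum_ext. intros q _. ring.
Qed.

(** * Power sums determine a multiset *)

Fixpoint elem_sym (p : nat -> R) (N k : nat) : R :=
  match N, k with
  | _, O => 1
  | O, S _ => 0
  | S N', S k' => elem_sym p N' (S k') + p N' * elem_sym p N' k'
  end.

Lemma elem_sym_0 p N : elem_sym p N O = 1.
Proof. destruct N; reflexivity. Qed.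

Lemma elem_sym_gt p N k : (N < k)%nat -> elem_sym p N k = 0.
Proof.
  revert k; induction N as [|N IH]; intros [|k] Hk; try lia; simpl; [reflexivity|].
  rewrite !IH by lia. ring.
Qed.

Lemma elem_sym_alternating_last p N k :
  fsum (S k) (fun i => (-1) ^ i * elem_sym p (S N) (k - i) * p N ^ S i) = p N * elem_sym p N k.
Proof.
  induction k as [|k IH].
  - simpl. rewrite elem_sym_0. ring.
  - rewrite fsum_shift.
    rewrite (fsum_ext (S k) _ (fun i => - p N * ((-1) ^ i * elem_sym p (S N) (k - i) * p N ^ S i)))
      by (intros; simpl; ring).
    rewrite fsum_scal_l, IH, Nat.sub_0_r. simpl. ring.
Qed.

Lemma newton_identity p N k :
  INR (S k) * elem_sym p N (S k) =
  fsum (S k) (fun i => (-1) ^ i * elem_sym p N (k - i) * power_sum N p (S i)).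
Proof.
  revert k. induction N as [|N IH]; intros k.
  - simpl elem_sym. rewrite (fsum_ext _ _ (fun _ => 0 * 0)), fsum_scal_l; [ring|].
    intros i _. unfold power_sum. simpl. ring.
  - set (a := p N).
    rewrite (fsum_ext (S k) _ (fun i => (-1) ^ i * elem_sym p N (k - i) * power_sum N p (S i) +
        a * (if Nat.ltb i k then (-1) ^ i * elem_sym p N (k - S i) * power_sum N p (S i) else 0) +
        (-1) ^ i * elem_sym p (S N) (k - i) * p N ^ S i)).
    2:{ intros i Hi. unfold power_sum at 1. cbn [fsum]. fold (power_sum N p (S i)).
        destruct (Nat.ltb_spec i k).
        - replace (k - i)%nat with (S (k - S i)) by lia. simpl. fold a. ring.
        - replace i with k by lia. rewrite Nat.sub_diag, !elem_sym_0. fold a. ring. }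
    rewrite !fsum_plus, elem_sym_alternating_last, fsum_scal_l, <- IH.
    assert (Hshift : fsum (S k) (fun i => if Nat.ltb i k
               then (-1) ^ i * elem_sym p N (k - S i) * power_sum N p (S i) else 0)
                 = INR k * elem_sym p N k).
    { cbn [fsum]. rewrite Nat.ltb_irrefl. destruct k as [|k]; [simpl; ring|].
      rewrite (fsum_ext (S k) _ (fun i => (-1) ^ i * elem_sym p N (k - i) * power_sum N p (S i))).
      - rewrite <- IH. ring.
      - intros i Hi. replace (Nat.ltb i (S k)) with true by (symmetry; apply Nat.ltb_lt; lia).
        reflexivity. }
    rewrite Hshift. fold a. change (elem_sym p (S N) (S k)) with (elem_sym p N (S k) + a * elem_sym p N k).
    rewrite (S_INR k). ring.
Qed.

Lemma elem_sym_of_power_sums p p' N :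
  (forall i, (1 <= i <= N)%nat -> power_sum N p i = power_sum N p' i) ->
  forall k, elem_sym p N k = elem_sym p' N k.
Proof.
  intros Hp k. induction k as [k IH] using (well_founded_ind Nat.lt_wf_0). destruct k as [|k].
  - rewrite !elem_sym_0. reflexivity.
  - destruct (Nat.le_gt_cases (S k) N).
    + apply (Rmult_eq_reg_l (INR (S k))); [|apply not_0_INR; lia].
      rewrite !newton_identity. apply fsum_ext. intros i Hi.
      rewrite IH, Hp by lia. reflexivity.
    + rewrite !elem_sym_gt by lia. reflexivity.
Qed.

Lemma fprod_elem_sym p N x :
  fprod N (fun q => x - p q) = fsum (S N) (fun k => (-1) ^ k * elem_sym p N k * x ^ (N - k)).
Proof.
  induction N as [|N IH]; [simpl; ring|].
  set (a := p N).
  rewrite (fsum_ext (S (S N)) _ (fun k => (-1) ^ k * elem_sym p N k * x ^ (S N - k) +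
     a * (match k with O => 0 | S k' => (-1) ^ k * elem_sym p N k' * x ^ (S N - k) end))).
  2:{ intros [|k] _; [rewrite !elem_sym_0; ring|].
      change (elem_sym p (S N) (S k)) with (elem_sym p N (S k) + a * elem_sym p N k). ring. }
  rewrite fsum_plus, fsum_scal_l.
  change (fsum (S (S N)) (fun k => (-1) ^ k * elem_sym p N k * x ^ (S N - k))) with
    (fsum (S N) (fun k => (-1) ^ k * elem_sym p N k * x ^ (S N - k)) +
     (-1) ^ S N * elem_sym p N (S N) * x ^ (S N - S N)).
  rewrite elem_sym_gt by lia.
  rewrite (fsum_shift (S N) (fun k => match k with O => 0
                                    | S k' => (-1) ^ k * elem_sym p N k' * x ^ (S N - k) end)).
  rewrite (fsum_ext (S N) (fun k => (-1) ^ k * elem_sym p N k * x ^ (S N - k))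
     (fun k => x * ((-1) ^ k * elem_sym p N k * x ^ (N - k))))
    by (intros k Hk; replace (S N - k)%nat with (S (N - k)) by lia; simpl; ring).
  rewrite (fsum_ext (S N) (fun i => match S i with O => 0
                                   | S k' => (-1) ^ S i * elem_sym p N k' * x ^ (S N - S i) end)
     (fun k => -1 * ((-1) ^ k * elem_sym p N k * x ^ (N - k)))) by (intros; simpl; ring).
  rewrite !fsum_scal_l, <- IH. cbn [fprod]. fold a. ring.
Qed.

Definition root_poly (l : list R) (x : R) : R := fold_right (fun y acc => (x - y) * acc) 1 l.

Lemma root_poly_perm l1 l2 x : Permutation l1 l2 -> root_poly l1 x = root_poly l2 x.
Proof. induction 1; simpl; try congruence; ring. Qed.

Lemma root_poly_eq_0 l x : root_poly l x = 0 -> In x l.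
Proof.
  induction l as [|y l IH]; simpl; intros H; [lra|].
  apply Rmult_integral in H as [H|H]; [left; lra | right; auto].
Qed.

Lemma continuity_root_poly l : continuity (root_poly l).
Proof.
  induction l as [|y l IH]; simpl.
  - apply continuity_const. intros ? ?; reflexivity.
  - apply (continuity_mult (fun x => x - y)); [|exact IH].
    apply continuity_minus; [apply derivable_continuous, derivable_id|].
    apply continuity_const. intros ? ?; reflexivity.
Qed.

Lemma continuity_pt_eq_at f g a : continuity_pt f a -> continuity_pt g a ->
  (forall x, x <> a -> f x = g x) -> f a = g a.
Proof.
  intros Hf Hg Hfg. apply (single_limit g (D_x no_cond a) (f a) (g a) a); [| |exact Hg].
  - intros e He. exists (a + e / 2). split; [split; [exact I | lra]|].
    unfold R_dist. rewrite Rabs_right; lra.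
  - intros e He. destruct (Hf e He) as [d [Hd Hfd]]. exists d. split; [exact Hd|].
    intros x [[_ Hx] Hxd]. rewrite <- Hfg by congruence.
    apply Hfd. repeat split; assumption.
Qed.

Lemma root_poly_inj l1 l2 : (forall x, root_poly l1 x = root_poly l2 x) -> Permutation l1 l2.
Proof.
  revert l2. induction l1 as [|a l1 IH]; intros l2 H.
  - destruct l2 as [|b l2]; [constructor|].
    specialize (H b). simpl in H. rewrite Rminus_diag in H. lra.
  - assert (Ha : In a l2).
    { apply root_poly_eq_0. rewrite <- H. simpl. ring. }
    apply in_split in Ha as [la [lb ->]].
    assert (Hmid : Permutation (a :: la ++ lb) (la ++ a :: lb)) by apply Permutation_middle.
    apply (Permutation_trans (l' := a :: la ++ lb)); [apply perm_skip, IH | exact Hmid].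
    assert (Hoff : forall x, x <> a -> root_poly l1 x = root_poly (la ++ lb) x).
    { intros x Hx. apply (Rmult_eq_reg_l (x - a)); [|lra].
      specialize (H x). rewrite <- (root_poly_perm _ _ x Hmid) in H. exact H. }
    intros x. destruct (Req_dec x a) as [->|Hx]; [|auto].
    apply continuity_pt_eq_at; [apply continuity_root_poly.. | exact Hoff].
Qed.

Lemma fprod_root_poly N p x : fprod N (fun q => x - p q) = root_poly (map p (seq 0 N)) x.
Proof.
  induction N as [|N IH]; [reflexivity|].
  rewrite seq_S, map_app. cbn [fprod]. rewrite IH. clear IH. unfold root_poly.
  rewrite fold_right_app. simpl.
  induction (map p (seq 0 N)) as [|y l IHl]; simpl; [ring|]. rewrite <- IHl. ring.
Qed.

(* Newton's identities turn the power sums into the coefficients of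
   prod_q (x - p q), whose roots are then the values p q with multiplicity. *)
Lemma power_sums_determine_values N (p p' : nat -> R) :
  (forall i, (1 <= i <= N)%nat -> power_sum N p i = power_sum N p' i) ->
  exists sigma, is_perm N sigma /\ forall q, (q < N)%nat -> p' q = p (sigma q).
Proof.
  intros Hps.
  assert (Hperm : Permutation (map p (seq 0 N)) (map p' (seq 0 N))).
  { apply root_poly_inj. intros x. rewrite <- !fprod_root_poly, !fprod_elem_sym.
    apply fsum_ext. intros k _. rewrite (elem_sym_of_power_sums p p' N Hps). reflexivity. }
  apply (Permutation_nth _ _ 0) in Hperm as [_ [sigma [Hlt [Hinj Hnth]]]].
  rewrite length_map, length_seq in *.
  exists sigma. split; [split; assumption|].
  assert (Hmap : forall (c : nat -> R) k, (k < N)%nat -> nth k (map c (seq 0 N)) 0 = c k).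
  { intros c k Hk. rewrite (nth_indep _ 0 (c O)), map_nth, seq_nth
      by (rewrite ?length_map, ?length_seq; exact Hk). reflexivity. }
  intros q Hq. specialize (Hnth q Hq). rewrite !Hmap in Hnth by (pose proof (Hlt q Hq); lia).
  exact Hnth.
Qed.

(** * Identifiability in the affiliation model *)

Lemma identifiable_separates {X Theta : Type} (meas : (X -> Prop) -> Prop)
    (F : Theta -> (X -> Prop) -> R) t1 t2 :
  finite_mixtures_identifiable meas F -> t1 <> t2 -> exists D, meas D /\ F t1 D <> F t2 D.
Proof.
  intros Hid Hne. apply NNPP. intros Hsep.
  assert (Hdirac := Hid 1%nat (fun _ => 1) (fun _ => 1) (fun _ => t1) (fun _ => t2)
    ltac:(lia) ltac:(intros; lra) ltac:(intros; lra) ltac:(simpl; ring) ltac:(simpl; ring)).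
  specialize (Hdirac ltac:(intros A HA; simpl; destruct (Req_dec (F t1 A) (F t2 A));
    [congruence | exfalso; eauto]) (fun s => s = t1)).
  simpl in Hdirac. rewrite dirac_self in Hdirac. unfold dirac, Defs.ind in Hdirac.
  destruct (excluded_middle_informative (t2 = t1)); [congruence | lra].
Qed.

Lemma two_component_mixture_labels {X Theta : Type} (meas : (X -> Prop) -> Prop)
    (F : Theta -> (X -> Prop) -> R) a0 a1 a0' a1' t0 t1 t0' t1' :
  finite_mixtures_identifiable meas F ->
  0 < a0 -> 0 < a1 -> 0 < a0' -> 0 < a1' -> a0 + a1 = a0' + a1' -> t0 <> t1 ->
  (forall A, meas A -> a0 * F t0 A + a1 * F t1 A = a0' * F t0' A + a1' * F t1' A) ->
  (t0' = t0 /\ t1' = t1) \/ (t0' = t1 /\ t1' = t0).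
Proof.
  intros Hid H0 H1 H0' H1' Hmass Hne Hmix.
  assert (Hm : a0 + a1 <> 0) by lra.
  assert (Hdirac := Hid 2%nat
    (fun i => if Nat.eqb i 0 then a0 / (a0 + a1) else a1 / (a0 + a1))
    (fun i => if Nat.eqb i 0 then a0' / (a0 + a1) else a1' / (a0 + a1))
    (fun i => if Nat.eqb i 0 then t0 else t1) (fun i => if Nat.eqb i 0 then t0' else t1')).
  simpl in Hdirac.
  assert (Hpt : forall t, a0 * dirac t0 (fun s => s = t) + a1 * dirac t1 (fun s => s = t) =
                          a0' * dirac t0' (fun s => s = t) + a1' * dirac t1' (fun s => s = t)).
  { intros t. apply (Rmult_eq_reg_l (/ (a0 + a1))); [|apply Rinv_neq_0_compat; exact Hm].
    transitivity (0 + a0 / (a0 + a1) * dirac t0 (fun s => s = t) +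
                  a1 / (a0 + a1) * dirac t1 (fun s => s = t)); [field; exact Hm|].
    rewrite Hdirac; [field; exact Hm | lia | | | field; exact Hm | rewrite Hmass; field; lra |].
    1,2: intros [|[|i]] Hi; simpl; try lia; apply Rdiv_lt_0_compat; lra.
    intros A HA. apply (Rmult_eq_reg_l (a0 + a1)); [|exact Hm].
    transitivity (a0 * F t0 A + a1 * F t1 A); [field; exact Hm|].
    rewrite Hmix by exact HA. field. exact Hm. }
  pose proof (Hpt t0) as E0. pose proof (Hpt t1) as E1.
  unfold dirac, Defs.ind in E0, E1.
  repeat destruct excluded_middle_informative; subst; try congruence; try lra; auto.
Qed.

Lemma power_sum_bounds Q pi : (2 <= Q)%nat -> (forall q, (q < Q)%nat -> 0 < pi q < 1) ->
  fsum Q pi = 1 ->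
  0 < power_sum Q pi 3 < power_sum Q pi 2 /\ power_sum Q pi 2 < 1.
Proof.
  intros HQ Hp Hpi. unfold power_sum.
  assert (Hlt : forall g h, (forall q, (q < Q)%nat -> g q < h q) -> fsum Q g < fsum Q h).
  { intros g h Hgh. apply Rlt_0_minus. rewrite <- fsum_minus.
    apply fsum_pos; [lia|]. intros q Hq. specialize (Hgh q Hq). lra. }
  repeat split.
  - apply fsum_pos; [lia|]. intros q Hq. apply pow_lt, Hp, Hq.
  - apply Hlt. intros q Hq. specialize (Hp q Hq). assert (0 < pi q * pi q) by nra. simpl. nra.
  - rewrite <- Hpi. apply Hlt. intros q Hq. specialize (Hp q Hq). simpl. nra.
Qed.

Lemma affil_weight_full {X Theta : Type} (x0 : X) (F : Theta -> (X -> Prop) -> R) al be ti to s :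
  (forall th, F th (fun _ => True) = 1) -> affil_weight x0 F al be ti to (fun _ => True) s = 1.
Proof. intros HF1. destruct s; unfold affil_weight; rewrite dirac_full, !HF1; ring. Qed.

Lemma joint_rect_K3_single_edge {X Theta : Type} (x0 : X) (F : Theta -> (X -> Prop) -> R)
    Q pi al be ti to (A : X -> Prop) :
  (forall th, F th (fun _ => True) = 1) -> fsum Q pi = 1 ->
  joint_rect x0 F Q pi al be ti to 3
    (fun i j => if andb (Nat.eqb i 0) (Nat.eqb j 1) then A else fun _ => True) =
  power_sum Q pi 2 * affil_weight x0 F al be ti to A true +
  (1 - power_sum Q pi 2) * affil_weight x0 F al be ti to A false.
Proof.
  intros HF1 Hpi.
  rewrite joint_rect_edge_moment, edge_moment_3, triangle_moment_closed by exact Hpi.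
  cbn -[affil_weight]. rewrite !affil_weight_full by exact HF1. ring.
Qed.

(* The edge (0,1) of K_3 has law (1 - m) delta_0 + s2 alpha F th_in + (1 - s2) beta F th_out:
   the atom fixes m, and identifiability of the remaining mixture fixes {th_in, th_out}. *)
Lemma same_law_K3_labels {X Theta : Type} (meas : (X -> Prop) -> Prop) (x0 : X)
    (F : Theta -> (X -> Prop) -> R) Q pi al be ti to pi' al' be' ti' to' :
  meas (fun x => x = x0) -> meas (fun _ => True) -> (forall th, F th (fun _ => True) = 1) ->
  no_atom_at x0 F -> finite_mixtures_identifiable meas F -> (2 <= Q)%nat ->
  valid_params Q pi al be ti to -> valid_params Q pi' al' be' ti' to' ->
  same_law_K meas x0 F Q 3 pi al be ti to pi' al' be' ti' to' ->
  (ti' = ti /\ to' = to) \/ (ti' = to /\ to' = ti).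
Proof.
  intros Hx0 HT HF1 Hna Hid HQ (Hp & Hpi & Hal & Hbe & Hth) (Hp' & Hpi' & Hal' & Hbe' & _) Hsame.
  destruct (power_sum_bounds Q pi HQ Hp Hpi) as [[Hs3 Hs32] Hs2].
  destruct (power_sum_bounds Q pi' HQ Hp' Hpi') as [[Hs3' Hs32'] Hs2'].
  assert (Hedge : forall A, meas A ->
    power_sum Q pi 2 * affil_weight x0 F al be ti to A true +
    (1 - power_sum Q pi 2) * affil_weight x0 F al be ti to A false =
    power_sum Q pi' 2 * affil_weight x0 F al' be' ti' to' A true +
    (1 - power_sum Q pi' 2) * affil_weight x0 F al' be' ti' to' A false).
  { intros A HA. rewrite <- !joint_rect_K3_single_edge by assumption.
    apply Hsame. intros i j _. destruct (andb _ _); assumption. }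
  assert (Hmass : power_sum Q pi 2 * al + (1 - power_sum Q pi 2) * be =
                 power_sum Q pi' 2 * al' + (1 - power_sum Q pi' 2) * be').
  { assert (Hatom := Hedge _ Hx0). unfold affil_weight in Hatom.
    rewrite !dirac_self, !Hna in Hatom. lra. }
  apply (two_component_mixture_labels meas F (power_sum Q pi 2 * al) ((1 - power_sum Q pi 2) * be)
    (power_sum Q pi' 2 * al') ((1 - power_sum Q pi' 2) * be')); try assumption.
  1-4: nra.
  intros A HA. specialize (Hedge A HA). unfold affil_weight in Hedge.
  assert (Hd := f_equal (Rmult (dirac x0 A)) Hmass). lra.
Qed.

Definition comp_indicator (c0 c : component) : R :=
  match c0, c with
  | Atom, Atom | CompA, CompA | CompB, CompB => 1
  | _, _ => 0
  end.

Definition triangle_edges (v01 v02 v12 : component -> R) : nat -> nat -> component -> R :=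
  fun i j => if Nat.eqb i 0 then (if Nat.eqb j 1 then v01 else v02) else v12.

Lemma mixture_moment_triangle Q pi kappa v01 v02 v12 :
  mixture_moment Q 3 pi kappa (triangle_edges v01 v02 v12) =
  triangle_moment Q pi (fun s => mix (kappa s) v01) (fun s => mix (kappa s) v02)
    (fun s => mix (kappa s) v12).
Proof. unfold mixture_moment. rewrite edge_moment_3. reflexivity. Qed.

Section SeparatedComponents.

Variables (X Theta : Type) (meas : (X -> Prop) -> Prop) (x0 : X).
Variables (F : Theta -> (X -> Prop) -> R) (ti to : Theta) (D : X -> Prop).
Hypotheses (Hx0 : meas (fun x => x = x0)) (HT : meas (fun _ => True)) (HD : meas D)
  (HFD : F ti D <> F to D) (HF1 : forall th, F th (fun _ => True) = 1) (Hna : no_atom_at x0 F).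
Variables (Q : nat) (pi pi' : nat -> R) (al be al' be' : R).
Hypotheses (HQ : (2 <= Q)%nat) (Hv : valid_params Q pi al be ti to).

Lemma same_law_K3_same_labels :
  valid_params Q pi' al' be' ti to ->
  same_law_K meas x0 F Q 3 pi al be ti to pi' al' be' ti to -> al = al' /\ be = be'.
Proof.
  intros Hv' Hsame.
  destruct Hv as (Hp & Hpi & Hal & Hbe & _). destruct Hv' as (_ & Hpi' & _).
  destruct (power_sum_bounds Q pi HQ Hp Hpi) as [[Hs3 _] Hs2].
  assert (Htri : forall v01 v02 v12,
    mixture_moment Q 3 pi (affil_kappa al be) (triangle_edges v01 v02 v12) =
    mixture_moment Q 3 pi' (affil_kappa al' be') (triangle_edges v01 v02 v12)).
  { intros. apply (same_law_K_mixture_moment meas x0 F ti to D Q 3 pi al be ti to pi' al' be' ti to);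
      auto; intros; apply affil_weight_mix. }
  pose proof (Htri (comp_indicator CompA) (fun _ => 1) (fun _ => 1)) as J1.
  pose proof (Htri (comp_indicator CompA) (comp_indicator CompA) (fun _ => 1)) as J2.
  pose proof (Htri (comp_indicator CompA) (comp_indicator CompA) (comp_indicator CompA)) as J3.
  pose proof (Htri (comp_indicator CompB) (fun _ => 1) (fun _ => 1)) as J4.
  rewrite !mixture_moment_triangle, !triangle_moment_closed in J1, J2, J3, J4 by assumption.
  cbv [mix affil_kappa comp_indicator] in J1, J2, J3, J4.
  set (s2 := power_sum Q pi 2) in *. set (s3 := power_sum Q pi 3) in *.
  set (s2' := power_sum Q pi' 2) in *. set (s3' := power_sum Q pi' 3) in *.
  assert (E1 : s2 * al = s2' * al') by lra.
  assert (E2 : s3 * al ^ 2 = s3' * al' ^ 2) by lra.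
  assert (E3 : s3 * al ^ 3 = s3' * al' ^ 3) by lra.
  assert (E4 : (1 - s2) * be = (1 - s2') * be') by lra.
  assert (Ha : al = al').
  { assert (Hz : s3 * al ^ 2 * (al' - al) = 0).
    { replace (s3 * al ^ 2 * (al' - al)) with (al' * (s3 * al ^ 2) - s3 * al ^ 3) by ring.
      rewrite E2, E3. ring. }
    apply Rmult_integral in Hz as [Hz|Hz]; [|lra].
    assert (0 < s3 * al ^ 2) by (apply Rmult_lt_0_compat; [lra | apply pow_lt; lra]). lra. }
  subst al'.
  assert (Hs : s2 = s2') by (apply (Rmult_eq_reg_r al); lra).
  split; [reflexivity|]. rewrite <- Hs in E4. apply (Rmult_eq_reg_l (1 - s2)); lra.
Qed.

(* Nodes 0, 1, 2 with 0 ~ 1, 0 ~ 2 and 1 !~ 2 are impossible, but with the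
   labels swapped this pattern is read as 0 !~ 1, 0 !~ 2, 1 ~ 2, which has positive mass. *)
Lemma same_law_K3_swapped_labels :
  valid_params Q pi' al' be' to ti ->
  ~ same_law_K meas x0 F Q 3 pi al be ti to pi' al' be' to ti.
Proof.
  intros Hv' Hsame.
  destruct Hv' as (Hp' & Hpi' & Hal' & Hbe' & _).
  destruct (power_sum_bounds Q pi' HQ Hp' Hpi') as [[_ Hs32'] _].
  assert (J := same_law_K_mixture_moment meas x0 F ti to D Q 3 pi al be ti to pi' al' be' to ti
    (affil_kappa al be) (fun s c => affil_kappa al' be' s (comp_swap c)) Hx0 HT HD HFD HF1 Hna
    (affil_weight_mix x0 F al be ti to) (affil_weight_mix_swap x0 F al' be' ti to) Hsame
    (triangle_edges (comp_indicator CompA) (comp_indicator CompA) (comp_indicator CompB))).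
  rewrite !mixture_moment_triangle, !triangle_moment_closed in J by apply Hv || exact Hpi'.
  cbv [mix affil_kappa comp_swap comp_indicator] in J.
  assert (0 < (power_sum Q pi' 2 - power_sum Q pi' 3) * (be' * be' * al')).
  { apply Rmult_lt_0_compat; [lra|]. repeat apply Rmult_lt_0_compat; lra. }
  lra.
Qed.

Lemma same_law_KQ_edge_moment :
  same_law_K meas x0 F Q Q pi al be ti to pi' al be ti to ->
  forall u, edge_moment Q Q pi u = edge_moment Q Q pi' u.
Proof.
  intros Hsame u.
  destruct Hv as (_ & _ & Hal & Hbe & _).
  pose (V i j c := match c with Atom => 0 | CompA => u i j true / al | CompB => u i j false / be end).
  assert (Hmom := same_law_K_mixture_moment meas x0 F ti to D Q Q pi al be ti to pi' al be ti to
    (affil_kappa al be) (affil_kappa al be) Hx0 HT HD HFD HF1 Hna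
    (affil_weight_mix x0 F al be ti to) (affil_weight_mix x0 F al be ti to) Hsame V).
  assert (Hu : (fun i j s => mix (affil_kappa al be s) (V i j)) = u).
  { extensionality i. extensionality j. extensionality s.
    destruct s; cbv [mix affil_kappa V]; field; lra. }
  unfold mixture_moment in Hmom. rewrite Hu in Hmom. exact Hmom.
Qed.

Lemma same_law_KQ_group_priors :
  valid_params Q pi' al be ti to ->
  same_law_K meas x0 F Q Q pi al be ti to pi' al be ti to ->
  exists sigma, is_perm Q sigma /\ forall q, (q < Q)%nat -> pi' q = pi (sigma q).
Proof.
  intros Hv' Hsame. apply power_sums_determine_values. intros k Hk.
  rewrite <- (edge_moment_star Q pi k Q), <- (edge_moment_star Q pi' k Q)
    by (apply Hv || apply Hv' || lia).
  apply same_law_KQ_edge_moment, Hsame.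
Qed.

End SeparatedComponents.

Theorem theorem6 (X Theta : Type) (meas : (X -> Prop) -> Prop) (x0 : X)
    (F : Theta -> (X -> Prop) -> R) (Q : nat) :
  is_sigma_algebra meas ->
  meas (fun x => x = x0) ->
  (forall th, is_prob_measure meas (F th)) ->
  no_atom_at x0 F ->
  finite_mixtures_identifiable meas F ->
  (2 <= Q)%nat ->
  forall (pi : nat -> R) (alpha beta : R) (th_in th_out : Theta)
         (pi' : nat -> R) (alpha' beta' : R) (th_in' th_out' : Theta),
  valid_params Q pi alpha beta th_in th_out ->
  valid_params Q pi' alpha' beta' th_in' th_out' ->
  (same_law_K meas x0 F Q 3 pi alpha beta th_in th_out pi' alpha' beta' th_in' th_out' ->
     alpha = alpha' /\ beta = beta' /\ th_in = th_in' /\ th_out = th_out') /\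
  (alpha = alpha' -> beta = beta' -> th_in = th_in' -> th_out = th_out' ->
   same_law_K meas x0 F Q Q pi alpha beta th_in th_out pi' alpha' beta' th_in' th_out' ->
     exists sigma : nat -> nat, is_perm Q sigma /\
       forall q, (q < Q)%nat -> pi' q = pi (sigma q)).
Proof.
  intros [HT _] Hx0 Hprob Hna Hid HQ pi al be ti to pi' al' be' ti' to' Hv Hv'.
  assert (HF1 : forall th, F th (fun _ => True) = 1) by (intros th; apply Hprob).
  assert (Hth : ti <> to) by apply Hv.
  destruct (identifiable_separates meas F ti to Hid Hth) as [D [HD HFD]].
  split.
  - intros Hsame.
    destruct (same_law_K3_labels meas x0 F Q pi al be ti to pi' al' be' ti' to'
      Hx0 HT HF1 Hna Hid HQ Hv Hv' Hsame) as [[-> ->]|[-> ->]].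
    + destruct (same_law_K3_same_labels _ _ meas x0 F ti to D Hx0 HT HD HFD HF1 Hna
        _ _ _ _ _ _ _ HQ Hv Hv' Hsame) as [-> ->].
      auto.
    + destruct (same_law_K3_swapped_labels _ _ meas x0 F ti to D Hx0 HT HD HFD HF1 Hna
        _ _ _ _ _ _ _ HQ Hv Hv' Hsame).
  - intros <- <- <- <-.
    eapply (same_law_KQ_group_priors _ _ meas x0 F ti to D); eassumption.
Qed.
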